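(* The set $\mathcal{SD}\subseteq C[0,1]$ of somewhere differentiable functions is not Haar-finite in $C[0,1]$.
   Context: $C[0,1]$ is the space of real-valued continuous functions on $[0,1]$ with the supremum norm, regarded as an abelian Polish group under addition. A function in $C[0,1]$ is somewhere differentiable if it has a derivative at some point. A subset $A$ of an abelian Polish group $X$ is Haar-finite if there are a Borel set $B\subseteq X$ with $A\subseteq B$ and a homeomorphic copy $C\subseteq X$ of $2^\omega$ such that $(C+x)\cap B$ is finite for all $x\in X$. *)

(* Defs.v *)
From HB Require Import structures.
From mathcomp Require Import all_boot all_order all_algebra.
From mathcomp Require Import all_classical all_reals all_analysis.

Set Implicit Arguments.
Unset Strict Implicit.
Unset Printing Implicit Defensive.

Import Order.TTheory GRing.Theory Num.Theory.
Import numFieldNormedType.Exports.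

Local Open Scope classical_set_scope.
Local Open Scope ring_scope.

(* [0, 1] is a type of its own (a subtype of R with the induced topology), so
   that equality in C[0,1] does not depend on values outside [0, 1]. *)
Notation unit_interval R := (set_type (`[0, 1]%classic : set R)).

Definition continuous01 (R : realType) : {pred unit_interval R -> R^o} :=
  [pred f : unit_interval R -> R^o | `[< continuous f >]].

Section C01_vector_space.
Variable R : realType.

Lemma continuous01_submod_closed : submod_closed (@continuous01 R).
Proof.
split; first by apply/asboolP => x; exact: (@cst_continuous _ R^o 0).
move=> a f g /asboolP cf /asboolP cg; apply/asboolP => x.
apply: (@continuousD _ R^o _ (a *: f) g x); last exact: cg.
apply: (@continuousZ _ R^o _ (cst a) f x); last exact: cf.
exact: (@cst_continuous _ R^o a).
Qed.

HB.instance Definition _ :=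
  GRing.isSubmodClosed.Build R (unit_interval R -> R^o) (@continuous01 R)
    continuous01_submod_closed.

Record C01 := MkC01 {
  C01_fun :> unit_interval R -> R^o;
  C01_funP : C01_fun \in @continuous01 R }.

HB.instance Definition _ := [isSub for C01_fun].
HB.instance Definition _ := [Choice of C01 by <:].
HB.instance Definition _ := [SubChoice_isSubLmodule of C01 by <:].

Definition sup_norm (f : C01) : R := sup (range (fun x => `|f x|)).

Lemma unit_interval_compact : compact [set: unit_interval R].
Proof.
move=> F PF _.
have F01 : (val @ F) `[0, 1]%classic.
  by apply: (@filterS _ F _ setT) => [x _|];
    [exact: set_mem (valP x) | exact: filterT].
have [p [p01 Fp]] := @segment_compact R 0 1 (val @ F) _ F01.
exists (exist _ p (mem_set p01)); split => // A B FA.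
move=> [_ [[W oW <-] /= Wp WB]].
have FvA : (val @ F) (val @` A).
  by apply: (@filterS _ F _ A) => // x Ax; exists x.
have [_ [[x Ax <-] Wx]] := Fp (val @` A) W FvA (open_nbhs_nbhs (conj oW Wp)).
by exists x; split => //; exact: WB.
Qed.

Lemma C01_continuous (f : C01) : continuous f.
Proof. exact/asboolP/(C01_funP f). Qed.

Lemma C01_bounded (f : C01) : has_sup (range (fun x => `|f x|)).
Proof.
have x0 : unit_interval R by exists 0; rewrite inE/= in_itv/= lexx ler01.
split; first by exists `|f x0|, x0.
have /compact_bounded[M [_ fM]] :=
  continuous_compact (continuous_subspaceT (@C01_continuous f))
    unit_interval_compact.
exists (M + 1) => _ [x _ <-].
by apply: (fM (M + 1)); [rewrite ltrDl | exists x].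
Qed.

Lemma sup_norm_ub (f : C01) x : `|f x| <= sup_norm f.
Proof. by apply: ub_le_sup; [exact: (C01_bounded f).2 | exists x]. Qed.

Lemma sup_norm_le (f : C01) (M : R) :
  (forall x, `|f x| <= M) -> sup_norm f <= M.
Proof.
move=> fM; apply: ge_sup; first exact: (C01_bounded f).1.
by move=> _ [x _ <-]; exact: fM.
Qed.

Lemma sup_normD (f g : C01) : sup_norm (f + g) <= sup_norm f + sup_norm g.
Proof.
apply: sup_norm_le => x; apply: le_trans (ler_normD _ _) _.
by apply: lerD; exact: sup_norm_ub.
Qed.

Lemma sup_normZ (a : R) (f : C01) : sup_norm (a *: f) = `|a| * sup_norm f.
Proof.
have le_normZ b h : sup_norm (b *: h) <= `|b| * sup_norm h.
  apply: sup_norm_le => x; rewrite [leLHS](normrM b (h x)).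
  by rewrite ler_wpM2l// sup_norm_ub.
apply/eqP; rewrite eq_le le_normZ/=.
have [->|a0] := eqVneq a 0.
  have [_ [x _ _]] := (C01_bounded f).1.
  by rewrite normr0 mul0r; exact: le_trans (sup_norm_ub _ x).
rewrite -ler_pdivlMl ?normr_gt0// -normfV.
by rewrite -[X in sup_norm X <= _](scalerK a0).
Qed.

Lemma sup_norm_eq0 (f : C01) : sup_norm f = 0 -> f = 0.
Proof.
move=> f0; apply/val_inj/funext => x; apply/eqP; rewrite -normr_le0.
by rewrite -[leRHS]f0; exact: sup_norm_ub.
Qed.

HB.instance Definition _ :=
  Lmodule_isNormed.Build R C01 sup_normD sup_normZ sup_norm_eq0.

End C01_vector_space.

Definition borel_set (X : topologicalType) : set (set X) := <<s @open X >>.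

Definition cantor_copy (X : topologicalType) (C : set X) : Prop :=
  exists (f : cantor_space -> X) (g : X -> cantor_space),
    [/\ continuous f, {within C, continuous g},
        cancel f g & range f = C].

Definition haar_finite (X : topologicalZmodType) (A : set X) : Prop :=
  exists B C : set X,
    [/\ borel_set B, A `<=` B, cantor_copy C &
        forall x : X, finite_set ([set c + x | c in C] `&` B)].

(* The limit is taken inside [0, 1], hence is one-sided at the endpoints. *)
Definition derivative_at (R : realType) (f : unit_interval R -> R)
    (x : unit_interval R) (l : R) : Prop :=
  (f y - f x) / (val y - val x) @[y --> x^'] --> l.

Definition somewhere_differentiable (R : realType) : set (C01 R) :=
  [set f | exists x l, derivative_at f x l].

(* Main.v *)
Require Import Defs.
From HB Require Import structures.
From mathcomp Require Import all_boot all_order all_algebra.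
From mathcomp Require Import all_classical all_reals all_analysis.
From mathcomp Require Import ring lra.

(** A copy of the Cantor set contains distinct functions f_n converging
    uniformly to some f in the copy. Cut d_n = f_n - f off by bumps with pairwise
    disjoint supports, the n-th one being 1 near x_n = 4^-n / 2. Since d_n -> 0
    uniformly, the sum phi of these pieces is continuous (also at 0, where the
    supports accumulate), and phi = d_n near x_n. Hence the single translation by
    - f - phi makes every f_n vanish near x_n, hence differentiable there, and
    infinitely many points of the translated copy are somewhere
    differentiable. *)

Set Implicit Arguments.
Unset Strict Implicit.
Unset Printing Implicit Defensive.

Import Order.TTheory GRing.Theory Num.Theory.
Import numFieldNormedType.Exports.

Local Open Scope classical_set_scope.
Local Open Scope ring_scope.

(** Convergence is pointwise, and coordinate [k] is [false] once [n > k]. A continuous injection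
    carries this to a convergent sequence of distinct points of the copy. *)
Lemma cantor_delta_cvg :
  ((fun n : nat => (fun k => k == n) : cantor_space) @ \oo -->
   ((fun _ => false) : cantor_space)).
Proof.
apply/pointwise_cvgP => k; apply: cvg_near_cst.
by exists k.+1 => // n /= kn; apply/negbTE; rewrite neq_ltn kn.
Qed.

Lemma continuous_val01 (R : realType) :
  continuous (val : unit_interval R -> R).
Proof. exact: (@initial_continuous (unit_interval R) R val). Qed.

Section bump.
Variable R : realType.

(* Equal to 1 at distance at most 4^-n / 8 from 4^-n / 2, and 0 at distance at
   least 4^-n / 4. *)
Definition bump (n : nat) (x : R) : R :=
  Num.max 0 (Num.min 1 (2 - 8 * `|4 ^+ n * x - 2^-1|)).

Lemma bump_ge0 n x : 0 <= bump n x.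
Proof. by rewrite /bump le_max lexx. Qed.

Lemma bump_le1 n x : bump n x <= 1.
Proof. by rewrite /bump ge_max ler01 ge_min lexx. Qed.

Lemma continuous_bump n : continuous (bump n).
Proof.
move=> x.
apply: (@continuous_max R R (cst 0)
  (cst 1 \min (fun x => 2 - 8 * `|4 ^+ n * x - 2^-1|))).
  exact: cvg_cst.
apply: continuous_min; first exact: cvg_cst.
apply: cvgB; first exact: cvg_cst.
apply: cvgMl_tmp; apply: cvg_norm; apply: cvgB; last exact: cvg_cst.
by apply: cvgMl_tmp; exact: cvg_id.
Qed.

Lemma bump_eq1 n x : `|4 ^+ n * x - 2^-1| <= 8^-1 -> bump n x = 1.
Proof.
move=> h; rewrite /bump min_l ?max_r//; lra.
Qed.

(** The support stops at 3/4, but the weaker bound 1 already gives the pairwise disjoint intervals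
    [(4^-(n+1), 4^-n)]. *)
Lemma bump_neq0 n x : bump n x != 0 -> 4^-1 < 4 ^+ n * x < 1.
Proof.
rewrite /bump => h; have {h} : `|4 ^+ n * x - 2^-1| < 4^-1.
  rewrite ltNge; apply: contra h => h; rewrite max_l// ge_min.
  by apply/orP; right; lra.
by rewrite ltr_norml => /andP[? ?]; apply/andP; split; lra.
Qed.

Lemma bump_disjoint m n x : bump m x != 0 -> bump n x != 0 -> m = n.
Proof.
wlog mn : m n / (m <= n)%N => [wl hm hn|hm hn].
  by case/orP: (leq_total m n) => ?; [exact: wl | apply/esym/wl].
move: mn; rewrite leq_eqVlt => /predU1P[//|mn].
(* For [m < n], [4 ^+ m * x > 4^-1] forces [4 ^+ n * x >= 1], against the upper bound for [n]. *)
have /andP[h _] := bump_neq0 hm; have /andP[_] := bump_neq0 hn.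
rewrite -(subnK mn) addnS -addSn exprD -mulrA ltNge => /negP[].
have : 1 <= 4 ^+ (n - m.+1) :> R by rewrite exprn_ege1// ler1n.
by rewrite exprS; move: h; set y := 4 ^+ m * x; nra.
Qed.

(** Where all bumps vanish every index qualifies; the choice is harmless, as the selected term is
    then 0. *)
Lemma ex_bump_index (x : R) : exists j, forall n, n != j -> bump n x = 0.
Proof.
have [[j hj]|h] := pselect (exists j, bump j x != 0).
  exists j => n nj; apply: contraNeq nj => hn.
  exact/eqP/(bump_disjoint hn hj).
by exists 0%N => n _; apply: contra_notP h => /eqP hn; exists n.
Qed.

Definition bump_index (x : R) : nat := projT1 (cid (ex_bump_index x)).

Lemma bump_indexP x n : n != bump_index x -> bump n x = 0.
Proof. exact: (projT2 (cid (ex_bump_index x))). Qed.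

End bump.

Section patchwork.
Variables (R : realType) (d : (C01 R)^nat).

(* The sum of all [bump n * d n]; at each point at most one term is nonzero. *)
Definition patchwork_fun (x : unit_interval R) : R^o :=
  bump (bump_index (val x)) (val x) * d (bump_index (val x)) x.

Lemma patchwork_partial N x :
  \sum_(n < N) bump n (val x) * d n x =
  if (bump_index (val x) < N)%N then patchwork_fun x else 0.
Proof.
case: ifPn => [jN|]; last rewrite -leqNgt => jN.
  rewrite (bigD1 (Ordinal jN))//= big1 ?addr0// => i ij.
  by rewrite bump_indexP ?mul0r//; apply: contraNneq ij => h; exact/eqP/val_inj.
rewrite big1// => i _; rewrite bump_indexP ?mul0r//.
by rewrite neq_ltn (leq_trans (ltn_ord i)).
Qed.

Lemma patchwork_fun_eq n (x : unit_interval R) :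
  bump n (val x) = 1 -> patchwork_fun x = d n x.
Proof.
move=> b1; rewrite /patchwork_fun.
have <- : n = bump_index (val x).
  by apply: contra_eq b1 => /bump_indexP ->; rewrite eq_sym oner_eq0.
by rewrite b1 mul1r.
Qed.

(** A uniform limit of continuous partial sums: at each point the error is 0 or a single term of
    index at least [N], so [d] tending to 0 suffices, without summability of the norms. *)
Lemma patchwork_continuous : d @ \oo --> 0 -> continuous patchwork_fun.
Proof.
move=> d0 x; have Fx : Filter (nbhs x) by exact: nbhs_filter.
apply/(@cvgrPdist_lt _ _ _ _ Fx) => e e0.
have e3 : 0 < e / 3 by rewrite divr_gt0.
have /cvgrPdist_lt/(_ _ e3)[N _ dN] := d0.
pose p (y : unit_interval R) : R := \sum_(n < N) bump n (val y) * d n y.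
have pP y : `|patchwork_fun y - p y| < e / 3.
  rewrite /p patchwork_partial; case: ifPn => [|].
    by rewrite subrr normr0.
  rewrite -leqNgt subr0 => /dN; rewrite /= sub0r normrN; apply: le_lt_trans.
  rewrite normrM ger0_norm ?bump_ge0//.
  apply: le_trans (sup_norm_ub _ y).
  by rewrite ler_piMl// bump_le1.
have cp : {for x, continuous p}.
  apply: cvg_big => [|n _]; first exact: add_continuous.
  apply: cvgM; last exact: C01_continuous.
  apply: continuous_comp; last exact: continuous_bump.
  exact: continuous_val01.
have /cvgrPdist_lt/(_ _ e3) := cp.
apply: filterS => y pxy.
have := pP x; have := pP y; rewrite distrC => py px.
have -> : patchwork_fun x - patchwork_fun y =
  (patchwork_fun x - p x) + (p x - p y) + (p y - patchwork_fun y) by ring.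
apply: le_lt_trans (ler_normD _ _) _.
apply: le_lt_trans (lerD (ler_normD _ _) (lexx _)) _.
lra.
Qed.

End patchwork.

Lemma locally0_somewhere_differentiable (R : realType) (f : C01 R)
    (x : unit_interval R) :
  (\forall y \near x, f y = 0) -> somewhere_differentiable f.
Proof.
move=> f0; exists x, 0; apply: cvg_near_cst; apply: cvg_within.
near=> y; rewrite (near f0 y)// (nbhs_singleton f0) subrr mul0r//.
Unshelve. all: by end_near.
Qed.

Theorem proposition1p4 (R : realType) :
  ~ haar_finite (@somewhere_differentiable R).
Proof.
move=> [B [C [_ SDB [f [g [cf _ fK <-]]] finB]]].
pose s n : cantor_space := fun k => k == n.
pose o : cantor_space := fun=> false.
pose d n := f (s n) - f o.
have d0 : d @ \oo --> 0.
  rewrite -(subrr (f o)); apply: cvgB; last exact: cvg_cst.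
  exact: (cvg_comp s f cantor_delta_cvg (cf o)).
pose phi := MkC01 (asboolT (patchwork_continuous d0)).
have sP n : somewhere_differentiable (f (s n) - f o - phi).
  have xn01 : (2^-1 / 4 ^+ n : R) \in (`[0, 1]%classic : set R).
    rewrite inE /= in_itv /= divr_ge0//= ler_pdivrMr// mul1r.
    by rewrite (@le_trans _ _ 1)// ?exprn_ege1// ?ler1n// invf_le1// ler1n.
  pose xn : unit_interval R := exist _ (2^-1 / 4 ^+ n) xn01.
  apply: (@locally0_somewhere_differentiable _ _ xn).
  (* At [xn] the product [4 ^+ n * val y] is exactly 1/2, the centre of the plateau of [bump n], so
     a whole neighbourhood lies in the plateau. *)
  have : \forall y \near xn, `|4 ^+ n * val y - 2^-1 : R| < 8^-1.
    have : val y @[y --> xn] --> val xn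
      by exact: continuous_val01.
    move=> /((@cvgMl_tmp _ _ _ _ _ (4 ^+ n))) /cvgrPdist_lt /(_ 8^-1).
    rewrite invr_gt0 ltr0n => /(_ isT); apply: filterS => y.
    by rewrite distrC /= mulrCA divff ?mulr1// expf_neq0.
  apply: filterS => y /ltW/bump_eq1 /(patchwork_fun_eq d) h.
  rewrite -[LHS]/(f (s n) y - f o y - patchwork_fun d y) h.
  by rewrite -[d n y]/(f (s n) y - f o y) subrr.
have inj : injective (fun n => f (s n) + (- f o - phi)).
  (* Since [g] undoes [f], this reduces to [s m = s n], and coordinate [m] tells these apart. *)
  move=> m n /addIr /(can_inj fK) /(congr1 (fun h => h m)).
  by rewrite /s eqxx => /esym/eqP.
(* The preimage of the finite intersection under this injection would be finite, yet it contains
   every natural number. *)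
apply: infinite_nat.
apply: sub_finite_set (finite_preimage (in2W inj) (finB (- f o - phi))).
move=> n _ /=; split; first by exists (f (s n)) => //; exists (s n).
by apply: SDB; rewrite addrA.
Qed.
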